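(* Let $(Y,\nu)$ be a probability space and let $A_1\supset A_2\supset\cdots$ be measurable subsets of $Y$ with $\nu(A_n)\to0$ as $n\to\infty$. Let $X=Y^{\mathbb{N}\cup\{0\}}$, $\mu=\nu^{\otimes(\mathbb{N}\cup\{0\})}$, let $T\colon X\to X$ be the left shift, and let $\mathcal{B}=\{B_1\supset B_2\supset\cdots\}$ with $B_n=\{x\in X: x[0]\in A_n\}$. Suppose that there exists $C>1$ such that for all but finitely many $m$ one has $$\mu(B_m)\geq \frac{C \log\log m}{m};$$ then $\mathcal{H}_{\mathrm{e.a.}}(\mathcal{B})$ has full $\mu$-measure. If, on the other hand, $$\mu(B_m)\leq \frac{\log\log m}{m}$$ for all but finitely many $m$, then $\mathcal{H}_{\mathrm{e.a.}}(\mathcal{B})$ has zero $\mu$-measure.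
   Context: $\mathbb{N}=\{1,2,3,\dots\}$. Points of $X$ are sequences $x=(x[0],x[1],x[2],\dots)$, and $(Tx)[i]=x[i+1]$. Put $O_m(x)=\{Tx,T^2x,\dots,T^mx\}$. The eventually always hitting set is $$\mathcal{H}_{\mathrm{e.a.}}(\mathcal{B})=\{x\in X: O_m(x)\cap B_m\neq\varnothing\text{ for all but finitely many }m\in\mathbb{N}\}.$$ *)

(* Defs.v *)
From HB Require Import structures.
From mathcomp Require Import all_boot all_order all_algebra.
From mathcomp Require Import all_classical all_reals all_analysis.

Set Implicit Arguments.
Unset Strict Implicit.
Unset Printing Implicit Defensive.

Import Order.TTheory GRing.Theory Num.Theory.

Local Open Scope classical_set_scope.
Local Open Scope ring_scope.

(* Generators of the product sigma-algebra on [nat -> Y]: the preimages of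
   measurable sets under the coordinate maps. *)
Definition coordinate_preimages d (Y : measurableType d) : set (set (nat -> Y)) :=
  \bigcup_i preimage_set_system setT (fun x : nat -> Y => x i) measurable.

(* The set of sequences over [Y], with the product sigma-algebra. *)
Definition seq_space d (Y : measurableType d) :=
  g_sigma_algebraType (@coordinate_preimages d Y).

(* [mu] is the product of countably many copies of [nu]: by uniqueness of
   extension from cylinders this determines [mu]. *)
Definition is_product_measure d (Y : measurableType d) (R : realType)
    (nu : probability Y R) (mu : probability (seq_space Y) R) : Prop :=
  forall (n : nat) (E : nat -> set Y), (forall i, measurable (E i)) ->
    mu [set x : seq_space Y | forall i, (i < n)%N -> E i (x i)]
    = (\prod_(i < n) nu (E i))%E.

Definition left_shift d (Y : measurableType d) (x : seq_space Y) : seq_space Y :=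
  fun i => x i.+1.

(* [orbit T m x] is {T x, T^2 x, ..., T^m x}: [x] itself is not listed. *)
Definition orbit (X : Type) (T : X -> X) (m : nat) (x : X) : set X :=
  [set iter i T x | i in [set i | (1 <= i <= m)%N]].

Definition eventually_always_hitting (X : Type) (T : X -> X) (B : nat -> set X) :
    set X :=
  [set x | \forall m \near \oo, orbit T m x `&` B m !=set0].

(* Main.v *)
(* Let p_m = nu (A m), L_m = ln (ln m) and let E_m be the event that none of
   x 1, ..., x m lies in A m, so that mu E_m = (1 - p_m)^m and the complement of
   the eventually always hitting set is limsup E_m.

   If p_m >= C L_m / m with C > 1, take integers n_k growing geometrically with
   ratio at most 1 + 1/M, where s = C / (1 + 1/M) > 1. For n_k <= m <= n_(k+1),
   E_m is contained in the event that x 1, ..., x n_k miss A n_(k+1), which has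
   probability at most exp (- s L_(n_(k+1))) = O(k^-s); apply Borel-Cantelli.

   If p_m <= L_m / m, look only at m = r!. Let u_r be the probability that none
   of E_(K!), ..., E_(r!) occurs. The coordinates in ((r-1)!, r!] are
   independent of the past and miss A (r!) with probability at least
   exp (- L_(r!)) = 1 / ln (r!) >= 1 / (r ln r), while the coordinates up to
   (r-1)! hit A (r!) with probability at most (r-1)! p_(r!) <= L_(r!) / r -> 0.
   Hence u_(r-1) - u_r >= (u_(r-1) - o(1)) / (r ln r), and the divergence of
   sum 1 / (r ln r) forces u_r -> 0. Only upper bounds on p are used, so p_m may
   be much smaller than L_m / m and may jump. *)

Require Import Defs.
From HB Require Import structures.
From mathcomp Require Import all_boot all_order all_algebra.
From mathcomp Require Import all_classical all_reals all_analysis.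
From mathcomp Require Import ring lra zify.
Import Order.TTheory GRing.Theory Num.Theory.
Local Open Scope classical_set_scope.
Local Open Scope ring_scope.

(** * Cylinder boxes, missing events and their independence *)

Definition box {d} {Y : measurableType d} (E : nat -> set Y) (n : nat) :
    set (seq_space Y) :=
  [set x : seq_space Y | forall i, (i < n)%N -> E i (x i)].

(** Index 0 never occurs because the orbit starts at T x: the event E_m is [miss (A m) 0 m]. *)
Definition miss {d} {Y : measurableType d} (S : set Y) (a b : nat) :
    set (seq_space Y) :=
  [set x : seq_space Y | forall i, (a < i <= b)%N -> ~ S (x i)].

Lemma measurable_box {d} {Y : measurableType d} (E : nat -> set Y) (n : nat) :
  (forall i, measurable (E i)) -> measurable (box E n).
Proof.
move=> mE; have -> : box E n =
    \bigcap_(i in [set i | (i < n)%N]) [set x : seq_space Y | E i (x i)].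
  by [].
apply: bigcap_measurableType => i _; apply: sub_sigma_algebra.
by exists i => //; exists (E i) => //; rewrite setTI.
Qed.

(** The length [n] is free above [b], so that missing events with different horizons become boxes of
    one common length. *)
Lemma missE {d} {Y : measurableType d} (S : set Y) (a b n : nat) :
  (b < n)%N ->
  miss S a b = box (fun i => if (a < i <= b)%N then ~` S else setT) n.
Proof.
move=> bn; apply/seteqP; split=> x /= xS i.
  by move=> _; case: ifP => // /xS.
move=> abi; have /andP[_ ib] := abi.
by have := xS i (leq_ltn_trans ib bn); rewrite abi.
Qed.

Lemma measurable_miss {d} {Y : measurableType d} (S : set Y) (a b : nat) :
  measurable S -> measurable (miss S a b).
Proof.
move=> mS; rewrite (missE S a b b.+1)//.
by apply: measurable_box => i; case: ifP => // _; exact: measurableC.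
Qed.

Lemma miss_cat {d} {Y : measurableType d} (S : set Y) (a b : nat) : (a <= b)%N ->
  miss S 0 b = miss S 0 a `&` miss S a b.
Proof.
move=> ab; apply/seteqP; split=> [x xS|x [xa xb] i /andP[i0 ib]].
  split=> i /andP[i0 ib]; apply: xS.
    by rewrite i0 (leq_trans ib).
  by rewrite (leq_trans _ i0).
by have [ia|ai] := leqP i a; [apply: xa|apply: xb]; rewrite ?i0 ?ai ?ia.
Qed.

Lemma boxI {d} {Y : measurableType d} (E F : nat -> set Y) (n : nat) :
  box E n `&` box F n = box (fun i => E i `&` F i) n.
Proof.
apply/seteqP; split=> [x [xE xF] i ni|x xEF]; first by split; [exact: xE|exact: xF].
by split=> i ni; have [] := xEF i ni.
Qed.

Lemma mu_box_miss {R : realType} {d} {Y : measurableType d} {nu : probability Y R}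
    {mu : probability (seq_space Y) R} (E : nat -> set Y) (S : set Y) (a b : nat) :
  is_product_measure nu mu -> (forall i, measurable (E i)) -> measurable S ->
  (a <= b)%N ->
  mu (box E a.+1 `&` miss S a b) =
  (mu (box E a.+1) * ((1 - fine (nu S)) ^+ (b - a))%:E)%E.
Proof.
move=> muP mE mS ab.
have -> : box E a.+1 `&` miss S a b =
    box (fun i => if (i <= a)%N then E i else ~` S) b.+1.
  apply/seteqP; split=> [x [xE xS] i|x xES].
    rewrite ltnS => ib; case: leqP => ia; first exact: xE.
    by apply: xS; rewrite ia.
  split=> i.
    by rewrite ltnS => ia; have := xES i (leq_trans ia ab); rewrite ia.
  by move=> /andP[ai ib]; have := xES i ib; rewrite leqNgt ai.
rewrite !muP//; last by move=> i; case: ifP => // _; exact: measurableC.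
have -> : b.+1 = (a.+1 + (b - a))%N by rewrite addSn subnKC.
elim: (b - a)%N => [|k IH].
  by rewrite addn0 expr0 mule1; apply: eq_bigr => -[i /=]; rewrite ltnS => ->.
rewrite addnS big_ord_recr/= IH leqNgt ltnS leq_addr/= probability_setC//.
by rewrite exprSr EFinM muleA EFinB fineK// fin_num_measure.
Qed.

Lemma mu_miss {R : realType} {d} {Y : measurableType d} {nu : probability Y R}
    {mu : probability (seq_space Y) R} (S : set Y) (a b : nat) :
  is_product_measure nu mu -> measurable S -> (a <= b)%N ->
  mu (miss S a b) = ((1 - fine (nu S)) ^+ (b - a))%:E.
Proof.
move=> muP mS ab.
have boxT : @box d Y (fun=> setT) a.+1 = setT by apply/seteqP; split.
have := mu_box_miss (fun=> setT) _ _ _ muP (fun=> measurableT) mS ab.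
by rewrite boxT setTI probability_setT mul1e.
Qed.

(* Inclusion-exclusion on the last removed box reduces the claim to boxes, so
   no pi-lambda argument is needed. *)
Lemma avoid_boxes_miss_indep {R : realType} {d} {Y : measurableType d}
    {nu : probability Y R} {mu : probability (seq_space Y) R}
    (G : nat -> nat -> set Y) (S : set Y) (a b k : nat) (E : nat -> set Y) :
  is_product_measure nu mu -> (forall j i, measurable (G j i)) ->
  measurable S -> (a <= b)%N -> (forall i, measurable (E i)) ->
  let W := \big[setI/setT]_(j < k) ~` box (G j) a.+1 in
  mu (box E a.+1 `&` W `&` miss S a b) =
  (mu (box E a.+1 `&` W) * ((1 - fine (nu S)) ^+ (b - a))%:E)%E.
Proof.
move=> muP mG mS ab mE /=; elim: k E mE => [|k IH] E mE.
  by rewrite big_ord0 setIT (mu_box_miss _ _ _ _ muP).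
rewrite big_ord_recr/=; set W := \big[_/_]_(_ < _) _; set B := box (G k) _.
set c : R := _ ^+ _; set M := miss _ _ _.
have mW : measurable W.
  by apply: bigsetI_measurable => j _; apply: measurableC; exact: measurable_box.
have mEW : measurable (box E a.+1 `&` W).
  by apply: measurableI => //; exact: measurable_box.
have mB : measurable B by exact: measurable_box.
have mM : measurable M by exact: measurable_miss.
(* The removed box is absorbed into [E], which is why the induction quantifies over [E]. *)
have EBW : box E a.+1 `&` W `&` B = box (fun i => E i `&` G k i) a.+1 `&` W.
  by rewrite setIAC boxI.
rewrite setIA -setDE.
rewrite setIDAC setIDA.
rewrite !measureD//; last 3 first.
- by rewrite ltey_eq fin_num_measure.
- exact: measurableI.
- by rewrite ltey_eq fin_num_measure//; exact: measurableI.
have IHE : mu (box E a.+1 `&` W `&` M) = (mu (box E a.+1 `&` W) * c%:E)%E.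
  exact: IH.
have IHB : mu (box E a.+1 `&` W `&` M `&` B) =
    (mu (box E a.+1 `&` W `&` B) * c%:E)%E.
  by rewrite setIAC EBW; apply: IH => i; exact: measurableI.
transitivity (mu (box E a.+1 `&` W `&` M) - mu (box E a.+1 `&` W `&` M `&` B))%E => //.
rewrite IHE IHB muleBl// fin_num_adde_defl// fin_numN fin_num_measure//.
exact: measurableI.
Qed.

(** * Estimates for logarithms, factorials and powers *)

Lemma ln_sub_le {R : realType} (a b : R) : 0 < a -> 0 < b ->
  ln a - ln b <= (a - b) / b.
Proof.
move=> a0 b0; rewrite -ln_div ?posrE// mulrBl divff ?gt_eqF//.
have ab0 : 0 < a / b by exact: divr_gt0.
have /le_ln1Dx : -1 < a / b - 1 by lra.
by rewrite subrKC.
Qed.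

Lemma ln_le_sqrt {R : realType} (x : R) : 0 < x -> ln x <= 2 * Num.sqrt x.
Proof.
move=> x0; rewrite -{1}(sqr_sqrtr (ltW x0)) lnXn ?sqrtr_gt0// -[X in X <= _]mulr_natl.
by rewrite ler_pM2l// ltW// ln_sublinear// sqrtr_gt0.
Qed.

(** Squares exp (1/2) <= 2, which is 1 + t <= exp t at t = -1/2. Hence the threshold 4, past which
    ln is at least 1 and ln ln is nonnegative. *)
Lemma expR1_le4 {R : realType} : expR 1 <= 4 :> R.
Proof.
have h : (expR 1 : R) = expR 2^-1 ^+ 2.
  by rewrite -expRM_natr; congr expR; field.
have : expR (- 2^-1) >= 2^-1 :> R by have := expR_ge1Dx (- 2^-1 : R); lra.
rewrite expRN lef_pV2 ?posrE ?expR_gt0// => h2; rewrite h.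
have -> : 4 = 2 ^+ 2 :> R by ring.
by rewrite ler_pXn2r// ?nnegrE ?expR_ge0.
Qed.

Lemma ln_nat_ge1 {R : realType} (n : nat) : (4 <= n)%N -> 1 <= ln (n%:R : R).
Proof.
move=> n4; rewrite -[X in X <= _](@expRK R) ler_ln ?posrE ?expR_gt0 ?ltr0n//.
  by rewrite (le_trans expR1_le4)// (ler_nat _ 4).
by rewrite (leq_trans _ n4).
Qed.

Lemma fact_le_expn (n : nat) : (n`! <= n ^ n)%N.
Proof.
elim: n => // n IH; rewrite factS expnS leq_mul2l/=.
rewrite (leq_trans IH)//; by case: n {IH} => // n; rewrite leq_exp2r.
Qed.

Lemma ln_fact_le {R : realType} (n : nat) : (0 < n)%N ->
  ln (n`!%:R : R) <= n%:R * ln n%:R.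
Proof.
move=> n0; rewrite mulr_natl -lnXn ?ltr0n// -natrX.
by rewrite ler_ln ?posrE ?ltr0n ?fact_gt0 ?expn_gt0 ?n0// ler_nat fact_le_expn.
Qed.

(** ln (n!) <= n ln n <= n^2, hence ln (ln (n!)) <= 2 ln n. Any o(n) bound would serve. *)
Lemma lnln_fact_le {R : realType} (n : nat) : (4 <= n)%N ->
  ln (ln (n`!%:R : R)) <= 4 * Num.sqrt n%:R.
Proof.
move=> n4; have n0 : (0 < n)%N by rewrite (leq_trans _ n4).
have nR : 0 < n%:R :> R by rewrite ltr0n.
have lf : 1 <= ln (n`!%:R : R).
  by rewrite ln_nat_ge1// (leq_trans n4)// fact_geq.
have : ln (n`!%:R : R) <= n%:R ^+ 2.
  rewrite (le_trans (ln_fact_le _ n0))// expr2 ler_pM2l//.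
  by rewrite ltW// ln_sublinear.
rewrite -ler_ln ?posrE ?exprn_gt0//; last by lra.
rewrite lnXn// -[X in _ <= X -> _]mulr_natl => /le_trans; apply.
by have := ln_le_sqrt _ nR; lra.
Qed.

Lemma lnln_fact_small {R : realType} (e : R) : 0 < e ->
  exists N : nat, forall n, (N <= n)%N -> ln (ln (n`!%:R : R)) <= e * n%:R.
Proof.
move=> e0; exists (maxn 4 (Num.truncn ((4 / e) ^+ 2)).+1) => n.
rewrite geq_max => /andP[n4 nN]; rewrite (le_trans (lnln_fact_le _ n4))//.
have nR : (4 / e) ^+ 2 <= n%:R.
  by rewrite (le_trans (ltW (truncnS_gt _)))// ler_nat.
have s : 4 / e <= Num.sqrt n%:R.
  rewrite -(ler_pXn2r (n:=2))// ?nnegrE ?sqrtr_ge0 ?sqr_sqrtr//.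
  by rewrite divr_ge0// ltW.
rewrite -[X in e * X](@sqr_sqrtr R n%:R)// expr2 mulrA ler_wpM2r ?sqrtr_ge0//.
by rewrite -ler_pdivrMl// mulrC.
Qed.

Lemma bernoulli_ineq {R : realType} (p : R) (n : nat) : 0 <= p -> p <= 1 ->
  1 - n%:R * p <= (1 - p) ^+ n.
Proof.
move=> p0 p1; elim: n => [|n IH]; first by rewrite mul0r subr0 expr0.
have e1 : (1 - p) ^+ n <= 1 by rewrite exprn_ile1//; lra.
rewrite exprSr mulrBr mulr1 -natr1 mulrDl mul1r.
have : (1 - p) ^+ n * p <= p by rewrite ler_piMl.
lra.
Qed.

(** With all [n] factors the bound can fail, since (1 - L / n)^n <= exp (- L). Dropping [m >= L] of
    them gives p / (1 - p) <= L / (n - m), and 1 - p >= exp (- p / (1 - p)) concludes. This is how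
    the constant 1 is reached without loss. *)
Lemma expRN_le_onem_exp {R : realType} (p L : R) (m n : nat) :
  0 <= p -> (m < n)%N -> p <= L / n%:R -> L <= m%:R ->
  expR (- L) <= (1 - p) ^+ (n - m).
Proof.
move=> p0 mn pL Lm.
have n0 : 0 < n%:R :> R by rewrite ltr0n (leq_trans _ mn).
have nm : 0 < n%:R - m%:R :> R by rewrite subr_gt0 ltr_nat.
have q0 : 0 < 1 - p.
  rewrite subr_gt0 (le_lt_trans pL)// ltr_pdivrMr// mul1r (le_lt_trans Lm)//.
  by rewrite ltr_nat.
have pq : p / (1 - p) <= L / (n - m)%:R.
  rewrite natrB ?(ltnW mn)// ler_pdivrMr// mulrAC ler_pdivlMr//.
  move: pL; rewrite ler_pdivlMr// => pL.
  have : p * L <= p * m%:R by rewrite ler_wpM2l.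
  lra.
have -> : - L = (- (L / (n - m)%:R)) * (n - m)%:R.
  by rewrite mulNr divfK// gt_eqF// ltr0n subn_gt0.
rewrite expRM_natr ler_pXn2r ?subn_gt0 ?nnegrE ?expR_ge0 ?(ltW q0)//.
apply: (@le_trans _ _ (expR (- (p / (1 - p))))); first by rewrite ler_expR lerN2.
rewrite expRN -[leRHS]invrK lef_pV2 ?posrE ?expR_gt0 ?invr_gt0//.
apply: le_trans (expR_ge1Dx _).
suff -> : 1 + p / (1 - p) = (1 - p)^-1 by [].
by field; rewrite gt_eqF.
Qed.

(** The sum of 1 / (x ln x) diverges because each term dominates an increment of ln ln, by the
    tangent bound for ln applied twice. *)
Lemma lnln_decr_absurd {R : realType} (c : R) (K : nat) (u : nat -> R) :
  0 < c -> (2 <= K)%N -> (forall k, 0 <= u k) ->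
  ~ (forall k, c / ((K + k)%:R * ln (K + k)%:R) <= u k - u k.+1).
Proof.
move=> c0 K2 u0 du.
have bnd k : c * (ln (ln (K + k)%:R) - ln (ln K%:R)) <= u 0%N - u k.
  elim: k => [|k IH]; first by rewrite addn0 !subrr mulr0.
  have x1 : 1 < (K + k)%:R :> R by rewrite (ltr_nat _ 1) (leq_trans K2)// leq_addr.
  have x0 : 0 < (K + k)%:R :> R by lra.
  have lx : 0 < ln (K + k)%:R :> R by exact: ln_gt0.
  have lx1 : 0 < ln (K + k).+1%:R :> R.
    by rewrite ln_gt0// (lt_trans x1)// ltr_nat.
  have d1 := ln_sub_le _ _ lx1 lx.
  have := @ln_sub_le R (K + k).+1%:R (K + k)%:R (ltr0Sn _ _) x0.
  have -> : (K + k).+1%:R - (K + k)%:R = 1 :> R by rewrite -natr1; ring.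
  move=> d2.
  have d3 : ln (ln (K + k.+1)%:R) - ln (ln (K + k)%:R)
      <= 1 / ((K + k)%:R * ln (K + k)%:R) :> R.
    rewrite addnS (le_trans d1)// invfM mulrA ler_wpM2r ?invr_ge0 ?(ltW lx)//.
  have : c * (ln (ln (K + k.+1)%:R) - ln (ln (K + k)%:R)) <= u k - u k.+1.
    by rewrite (le_trans _ (du k))// -[c / _]mulr1 -mulrA ler_pM2l// mulrC.
  lra.
(* At this height [c] times the growth of ln ln since [K] is [u 0 + 1], more than [u] can lose. *)
pose M := expR (expR (ln (ln K%:R) + (u 0%N + 1) / c)).
pose k := (Num.truncn M).+1.
have Mk : M <= (K + k)%:R.
  by rewrite (le_trans (ltW (truncnS_gt _)))// ler_nat leq_addl.
have M0 : 0 < M by exact: expR_gt0.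
have : ln (ln M) <= ln (ln (K + k)%:R).
  have lM : ln M <= ln (K + k)%:R by rewrite ler_ln ?posrE ?(lt_le_trans M0).
  have lM0 : 0 < ln M by rewrite expRK expR_gt0.
  by rewrite ler_ln ?posrE ?(lt_le_trans lM0).
rewrite !expRK => h.
have := bnd k; have := u0 k.
have : c * ((u 0%N + 1) / c) <= c * (ln (ln (K + k)%:R) - ln (ln K%:R)).
  by rewrite ler_pM2l//; lra.
by rewrite mulrC divfK ?gt_eqF//; lra.
Qed.

(** * Loss of avoidance probability in one block *)

Lemma fine_measure_split {R : realType} {d} {T : measurableType d}
    (mu : probability T R) (A B : set T) : measurable A -> measurable B ->
  fine (mu A) = fine (mu (A `\` B)) + fine (mu (A `&` B)).
Proof.
move=> mA mB; rewrite (measureDI mu mA mB) fineD// fin_num_measure//.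
  exact: measurableD.
exact: measurableI.
Qed.

(** The mass lost is that of [W] together with a miss on [(0, b]], which is split at [a]. The late
    miss is independent of everything up to [a]. The early miss may depend on [W], so its complement
    is merely subtracted. *)
Lemma avoid_box_decrement {R : realType} {d} {Y : measurableType d}
    {nu : probability Y R} {mu : probability (seq_space Y) R}
    (G : nat -> nat -> set Y) (S : set Y) (a b k : nat)
    (W := \big[setI/setT]_(j < k) ~` box (G j) a.+1) (p := fine (nu S)) :
  is_product_measure nu mu -> (forall j i, measurable (G j i)) ->
  measurable S -> (a <= b)%N ->
  (1 - p) ^+ (b - a) * (fine (mu W) - (1 - (1 - p) ^+ a)) <=
  fine (mu W) - fine (mu (W `\` miss S 0 b)).
Proof.
move=> muP mG mS ab.
have mW : measurable W.
  by apply: bigsetI_measurable => j _; apply: measurableC; exact: measurable_box.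
have mQ : measurable (@miss _ Y S 0 a) by exact: measurable_miss.
have mE : measurable (@miss _ Y S 0 b) by exact: measurable_miss.
rewrite [X in _ <= X - _](fine_measure_split mu _ _ mW mE) addrAC subrr add0r.
have -> : W `&` miss S 0 b = miss S 0 a `&` W `&` miss S a b.
  by rewrite (miss_cat _ _ _ ab) setIA [W `&` _]setIC.
have indep : mu (miss S 0 a `&` W `&` miss S a b) =
    (mu (miss S 0 a `&` W) * ((1 - p) ^+ (b - a))%:E)%E.
  rewrite (missE S 0 a a.+1)//; apply: avoid_boxes_miss_indep => // i.
  by case: ifP => // _; exact: measurableC.
have p1 : p <= 1.
  by rewrite -lee_fin fineK ?fin_num_measure// probability_le1.
rewrite indep fineM ?fin_num_measure//=; last exact: measurableI.
rewrite mulrC ler_wpM2r ?exprn_ge0 ?subr_ge0//.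
have Q : fine (mu (miss S 0 a)) = (1 - p) ^+ a.
  by rewrite (mu_miss _ _ _ muP)//= subn0.
have mD : measurable (W `\` miss S 0 a) by exact: measurableD.
have mC : measurable (~` @miss _ Y S 0 a) by exact: measurableC.
have : fine (mu (W `\` miss S 0 a)) <= fine (mu (~` miss S 0 a)).
  by rewrite fine_le ?fin_num_measure ?le_measure ?inE//; exact: subIsetr.
rewrite probability_setC// -(fineK (fin_num_measure mu _ mQ)) -EFinB/= Q.
rewrite [X in _ -> X - _ <= _](fine_measure_split mu _ _ mW mQ) setIC.
lra.
Qed.

(** * The hitting set as a lower limit of events *)

Lemma iter_left_shift {d} {Y : measurableType d} (i : nat) (x : seq_space Y) (j : nat) :
  iter i (@left_shift d Y) x j = x (i + j)%N.
Proof. by elim: i j => // i IH j; rewrite iterS /left_shift IH addnS. Qed.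

Lemma eventually_always_hittingE {d} {Y : measurableType d} (A : nat -> set Y) :
  eventually_always_hitting (@left_shift d Y)
    (fun n => [set x : seq_space Y | A n (x 0%N)]) =
  \bigcup_N \bigcap_(m in [set m | (N <= m)%N]) ~` miss (A m) 0 m.
Proof.
have hit (x : seq_space Y) m :
    Defs.orbit (@left_shift d Y) m x `&` [set x : seq_space Y | A m (x 0%N)] !=set0 <->
    ~ miss (A m) 0 m x.
  split=> [[_ [[i im <-]]]/= Ai xm|xm].
    by apply: (xm i im); rewrite iter_left_shift addn0 in Ai.
  have [i im Ai] : exists2 i, (0 < i <= m)%N & A m (x i).
    apply: contrapT => h; apply: xm => i im Ai; apply: h; by exists i.
  exists (iter i (@left_shift d Y) x); split; first by exists i.
  by rewrite /= iter_left_shift addn0.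
apply/seteqP; split=> x [N _ xN]; exists N => // m Nm.
  by apply/hit; exact: xN.
by apply/hit; exact: xN.
Qed.

Lemma measurable_eventually_always_hitting {d} {Y : measurableType d}
    (A : nat -> set Y) : (forall n, (1 <= n)%N -> measurable (A n)) ->
  measurable (eventually_always_hitting (@left_shift d Y)
    (fun n => [set x : seq_space Y | A n (x 0%N)])).
Proof.
move=> mA; rewrite eventually_always_hittingE.
apply: bigcup_measurable => N _; apply: bigcap_measurableType => m _.
apply: measurableC; case: m => [|m]; last by apply: measurable_miss; exact: mA.
(* [A 0] need not be measurable, but the index range [(0, 0]] is empty. *)
have -> : miss (A 0%N) 0 0 = setT :> set (seq_space Y) => //.
by apply/seteqP; split=> // x _ [|i].
Qed.

(** * The null half, along factorials *)

(** By contradiction: if [e = mu V] is positive, then every [u k] is at least [e]. Once early hits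
    cost at most [e / 2], each decrement is at least (e / 2) / (r ln r), against divergence. *)
Lemma miss_factorials_null {R : realType} {d} {Y : measurableType d}
    {nu : probability Y R} {mu : probability (seq_space Y) R}
    (A : nat -> set Y) (N K0 : nat) :
  is_product_measure nu mu -> (forall n, (1 <= n)%N -> measurable (A n)) ->
  (forall m, (N <= m)%N -> fine (nu (A m)) <= ln (ln m%:R) / m%:R) ->
  mu (\bigcap_(j in [set j | (K0 <= j)%N]) ~` miss (A j`!) 0 j`!) = 0%E.
Proof.
move=> muP mA nuA; set V := \bigcap_(_ in _) _.
have mE j : measurable (@miss _ Y (A j`!) 0 j`!).
  by apply: measurable_miss; apply: mA; exact: fact_gt0.
have mV : measurable V.
  by apply: bigcap_measurableType => j _; exact: measurableC.
apply: contrapT => V0; pose e := fine (mu V).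
have eE : mu V = e%:E by rewrite fineK// fin_num_measure.
have e0 : 0 < e.
  by rewrite lt_neqAle -!lee_fin -eE measure_ge0 andbT eq_sym; apply/eqP => e0;
    apply: V0; rewrite eE e0.
have e1 : e <= 1 by rewrite -lee_fin -eE probability_le1.
have [M HM] := @lnln_fact_small R (e / 2) ltac:(lra).
(* 3 gives [r >= 4], [N] activates the bound on [nu], [K0] makes all the avoided events occur in
   [V], and [M] gives [L <= e / 2 * r]. *)
pose K := maxn 3 (maxn N (maxn K0 M)).
have [K3 [KN [KK0 KM]]] : (3 <= K)%N /\ (N <= K)%N /\ (K0 <= K)%N /\ (M <= K)%N.
  by rewrite /K !leq_max !leqnn !orbT.
pose E i := @miss _ Y (A (K + i).+1`!) 0 (K + i).+1`!.
pose u k := fine (mu (\big[setI/setT]_(i < k) ~` E i)).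
have mW k : measurable (\big[setI/setT]_(i < k) ~` E i).
  by apply: bigsetI_measurable => i _; apply: measurableC; exact: mE.
have ue k : e <= u k.
  rewrite fine_le ?fin_num_measure ?le_measure ?inE//.
  rewrite -(bigcap_mkord k (fun i => ~` E i)) => x Vx i _; apply: Vx => /=.
  by rewrite (leq_trans KK0)// ltnW// ltnS leq_addr.
apply: (@lnln_decr_absurd R (e / 2) K.+1 u); [lra|by rewrite ltnS ltnW// ltnW|..].
  by move=> k; rewrite (le_trans _ (ue k))// ltW.
move=> k; rewrite addSn.
set r := (K + k).+1; set a := (K + k)`!; set b := r`!.
have r4 : (4 <= r)%N by rewrite ltnS (leq_trans K3)// leq_addr.
have bE : b = (r * a)%N by rewrite /b factS.
have a0 : (0 < a)%N by exact: fact_gt0.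
have ab : (a < b)%N by rewrite bE ltn_Pmull// (leq_trans _ r4).
have rb : (r <= b)%N by exact: fact_geq.
pose L : R := ln (ln b%:R).
have Lr : L <= e / 2 * r%:R.
  by apply: HM; rewrite (leq_trans KM)// ltnW// ltnS leq_addr.
set p := fine (nu (A b)).
have p0 : 0 <= p by exact: fine_ge0.
have mAb : measurable (A b) by apply: mA; exact: fact_gt0.
have p1 : p <= 1 by rewrite -lee_fin fineK ?fin_num_measure// probability_le1.
have pL : p <= L / b%:R.
  by apply: nuA; rewrite (leq_trans KN)// (leq_trans _ rb)// ltnW// ltnS leq_addr.
have r0 : 0 < r%:R :> R by rewrite ltr0n.
have aR : 0 < a%:R :> R by rewrite ltr0n.
(* As [e <= 1], L <= r / 2 <= r - 1 <= (r - 1)! = a; this is the slack that [expRN_le_onem_exp] asks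
   for. *)
have La : L <= a%:R.
  have : (K + k)%:R <= a%:R :> R by rewrite ler_nat; exact: fact_geq.
  have : e / 2 * r%:R <= 2^-1 * r%:R by rewrite ler_wpM2r ?(ltW r0)//; lra.
  have : 4 <= r%:R :> R by rewrite (ler_nat _ 4).
  have : r%:R = (K + k)%:R + 1 :> R by rewrite natr1.
  lra.
have hit_early : 1 - (1 - p) ^+ a <= e / 2.
  have := bernoulli_ineq p a p0 p1.
  have : a%:R * p <= e / 2.
    rewrite (@le_trans _ _ (a%:R * (L / b%:R)))//; first by rewrite ler_wpM2l// ltW.
    have -> : a%:R * (L / b%:R) = L / r%:R.
      by rewrite bE natrM; field; rewrite !gt_eqF.
    by rewrite ler_pdivrMr.
  lra.
(* exp (- L) is exactly 1 / ln b, and ln (r!) <= r ln r. *)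
have miss_late : 1 / (r%:R * ln r%:R) <= (1 - p) ^+ (b - a).
  have lb : 1 <= ln (b%:R : R) by rewrite ln_nat_ge1// (leq_trans r4).
  have lb0 : 0 < ln (b%:R : R) by lra.
  apply: le_trans (expRN_le_onem_exp _ _ _ _ p0 ab pL La).
  rewrite expRN lnK// div1r lef_pV2 ?posrE//.
    by rewrite ln_fact_le.
  by rewrite mulr_gt0// ln_gt0// (ltr_nat _ 1) (leq_trans _ r4).
(* For [j < k] the horizon (K + j + 1)! is at most [a], so all earlier events are boxes of length
   [a.+1]. *)
pose G j i := if (0 < i <= (K + j).+1`!)%N then ~` A (K + j).+1`! else setT.
have mG j i : measurable (G j i).
  by rewrite /G; case: ifP => // _; apply: measurableC; apply: mA; exact: fact_gt0.
have WE : \big[setI/setT]_(j < k) ~` E j =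
    \big[setI/setT]_(j < k) ~` box (G j) a.+1.
  apply: eq_bigr => j _; rewrite /E (missE _ _ _ a.+1)// ltnS.
  by apply: leq_fact; rewrite -addnS leq_add2l.
have := avoid_box_decrement G _ a b k muP mG mAb (ltnW ab).
rewrite -WE -/p -/(u k) => dec.
have -> : u k.+1 = fine (mu (\big[setI/setT]_(j < k) ~` E j `\` E k)).
  by rewrite /u big_ord_recr/= setDE.
apply: le_trans dec; rewrite -[e / 2]mul1r mulrAC.
have uk := ue k; apply: ler_pM => //; [|lra|lra].
by rewrite divr_ge0// mulr_ge0 ?(ltW r0)// ln_ge0// (ler_nat _ 1) (leq_trans _ r4).
Qed.

(** * The full-measure half: a geometric subsequence and summability *)

(** Comparison of y^(-1-s) with the integral of its power, for y = x + 1: since ln y - ln x >= 1 /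
    y, x^(-s) >= y^(-s) (1 + s / y). *)
Lemma expR_ln_telescope {R : realType} (s x : R) : 0 < s -> 0 < x ->
  expR (- ((1 + s) * ln (x + 1))) <=
  s^-1 * (expR (- (s * ln x)) - expR (- (s * ln (x + 1)))).
Proof.
move=> s0 x0; set y := x + 1; have y0 : 0 < y by rewrite /y; lra.
have yE : ln y = - ln y^-1 by rewrite lnV ?posrE// opprK.
have -> : - ((1 + s) * ln y) = - (s * ln y) + ln y^-1.
  by rewrite lnV ?posrE//; ring.
rewrite expRD lnK ?posrE ?invr_gt0// ler_pdivlMl//.
have lxy : s * y^-1 <= s * ln y - s * ln x.
  rewrite -mulrBr ler_pM2l//; have := ln_sub_le _ _ x0 y0.
  have -> : (x - y) / y = - y^-1 by rewrite /y; field; rewrite gt_eqF.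
  lra.
have : expR (- (s * ln y)) * (1 + s * y^-1) <= expR (- (s * ln x)).
  have -> : - (s * ln x) = - (s * ln y) + (s * ln y - s * ln x) by ring.
  rewrite expRD ler_pM2l ?expR_gt0// (le_trans (expR_ge1Dx _))//.
  by rewrite ler_expR.
lra.
Qed.

Lemma nneseries_telescope_lty {R : realType} (u : nat -> \bar R) (t : nat -> R) :
  (forall k, (0 <= u k)%E) -> (forall k, (u k <= (t k - t k.+1)%:E)%E) ->
  (forall k, 0 <= t k) -> (\sum_(k <oo) u k < +oo)%E.
Proof.
move=> u0 ut t0; apply: (@le_lt_trans _ _ (t 0%N)%:E); last exact: ltry.
apply: lime_le; first by apply: is_cvg_nneseries => *; exact: u0.
apply: nearW => n; apply: (@le_trans _ _ (t 0%N - t n)%:E).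
  elim: n => [|n IH]; first by rewrite big_geq// subrr.
  rewrite big_nat_recr//= (le_trans (leeD IH (ut n)))// -EFinD lee_fin.
  lra.
by rewrite lee_fin; have := t0 n; lra.
Qed.

(** Adding [n k %/ M] keeps the ratio at most 1 + 1/M. As [n k >= M], the quotient is positive, so
    rounding down at most halves n_k / M and the ratio is at least 1 + 1/(2M). *)
Lemma bounded_ratio_sequence (M N : nat) : (0 < M)%N ->
  exists n : nat -> nat, [/\ (N <= n 0)%N, forall k, (n k < n k.+1)%N,
    forall k, (n k.+1 * M <= n k * M.+1)%N &
    forall k, (n k * (2 * M).+1 <= n k.+1 * (2 * M))%N].
Proof.
move=> M0; pose n := fix n k :=
  if k is k'.+1 then (n k' + n k' %/ M)%N else maxn N M.
have nM k : (M <= n k)%N.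
  elim: k => [|k IH]; first exact: leq_maxr.
  exact: leq_trans IH (leq_addr _ _).
have q1 k : (0 < n k %/ M)%N by rewrite divn_gt0.
exists n; split => [|k|k|k].
- exact: leq_maxl.
- by rewrite /= -addn1 leq_add2l.
- by rewrite /= mulnDl mulnS addnC leq_add2r leq_divM.
- rewrite /= mulnDl mulnS addnC leq_add2l.
  have := ltn_ceil (n k) M0; have := q1 k; nia.
Qed.

Lemma increasing_bracket (n : nat -> nat) (K m : nat) :
  (forall k, (n k < n k.+1)%N) -> (n K <= m)%N ->
  exists2 j, (K <= j)%N & (n j <= m < n j.+1)%N.
Proof.
move=> nS nKm; have nge i : (i <= n (K + i))%N.
  elim: i => // i IH; rewrite addnS; exact: leq_ltn_trans IH (nS _).
have [i] : exists i, (m < n (K + i))%N by exists m.+1; exact: nge.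
elim: i => [|i IH]; first by rewrite addn0 ltnNge nKm.
have [/IH//|ni] := ltnP m (n (K + i)%N).
by rewrite addnS => mn; exists (K + i)%N; [exact: leq_addr|rewrite ni].
Qed.

(** 1 - p <= exp (- p). Testing only [a] coordinates against the threshold of index [b] costs the
    factor a / b >= M / (M + 1). *)
Lemma miss_late_prob_le {R : realType} (C p : R) (M a b : nat) :
  0 < C -> p <= 1 -> (4 <= b)%N -> (0 < M)%N ->
  (b * M <= a * M.+1)%N -> C * ln (ln b%:R) / b%:R <= p ->
  (1 - p) ^+ a <= expR (- (C * M%:R / M.+1%:R * ln (ln b%:R))).
Proof.
move=> C0 p1 b4 M0 ba Cp.
have b0 : 0 < b%:R :> R by rewrite ltr0n (leq_trans _ b4).
have M1 : 0 < M.+1%:R :> R by [].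
have ll0 : 0 <= ln (ln b%:R) :> R by rewrite ln_ge0// ln_nat_ge1.
have p0 : 0 <= p.
  by apply: le_trans Cp; rewrite divr_ge0 ?(ltW b0)// mulr_ge0// ltW.
apply: (@le_trans _ _ (expR (- p) ^+ a)).
  by rewrite lerXn2r ?nnegrE ?expR_ge0 ?subr_ge0//; have := expR_ge1Dx (- p).
rewrite -expRM_natr ler_expR mulNr lerN2.
apply: (@le_trans _ _ (C * ln (ln b%:R) / b%:R * a%:R)); last by rewrite ler_wpM2r.
have ratio : M%:R / M.+1%:R <= a%:R / b%:R :> R.
  by rewrite ler_pdivrMr// mulrAC ler_pdivlMr// -!natrM ler_nat mulnC.
rewrite -(mulrA C) (mulrAC C) (mulrAC _ _ a%:R) -(mulrA _ a%:R).
by rewrite ler_wpM2l// mulr_ge0// ltW.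
Qed.

(** Because rho <= 4 <= n 0, the power rho^(k+1) is already below [n k]. The term ln (ln rho) may be
    negative, but only contributes a constant factor after exponentiation. *)
Lemma geometric_lnln_ge {R : realType} (M : nat) (n : nat -> nat)
    (rho := (2 * M).+1%:R / (2 * M)%:R : R) : (0 < M)%N -> (4 <= n 0)%N ->
  (forall k, (n k * (2 * M).+1 <= n k.+1 * (2 * M))%N) ->
  forall k, ln (k.+1%:R + 1) + ln (ln rho) <= ln (ln (n k.+1)%:R).
Proof.
move=> M0 n4 nS k; rewrite natr1.
have M2 : 0 < (2 * M)%:R :> R by rewrite ltr0n muln_gt0.
have rho1 : 1 < rho.
  by rewrite ltr_pdivlMr// mul1r ltr_nat.
have rho2 : rho <= 4.
  by rewrite ler_pdivrMr// -natrM ler_nat; lia.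
have c0 : 0 < ln rho by exact: ln_gt0.
have grow j : rho ^+ j.+1 <= (n j)%:R.
  elim: j => [|j IH]; first by rewrite expr1 (le_trans rho2)// (ler_nat _ 4).
  rewrite exprSr (@le_trans _ _ ((n j)%:R * rho))//.
    by rewrite ler_wpM2r// ltW// (lt_trans _ rho1).
  by rewrite mulrA ler_pdivrMr// -!natrM ler_nat.
have rho0 : 0 < rho by rewrite (lt_trans _ rho1).
have nk0 : 0 < (n k.+1)%:R :> R by rewrite (lt_le_trans _ (grow _))// exprn_gt0.
have : k.+2%:R * ln rho <= ln (n k.+1)%:R.
  by rewrite mulr_natl -lnXn// ler_ln ?posrE ?exprn_gt0.
rewrite -lnM ?posrE// => h; rewrite ler_ln ?posrE ?mulr_gt0//.
by rewrite (lt_le_trans _ h)// mulr_gt0.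
Qed.

Lemma decreasing_sets_le {T : Type} (A : nat -> set T) :
  (forall n, (1 <= n)%N -> A n.+1 `<=` A n) ->
  forall m n, (1 <= m <= n)%N -> A n `<=` A m.
Proof.
move=> dA m n /andP[m1]; elim: n => [|n IH]; first by case: m m1.
rewrite leq_eqVlt => /predU1P[->//|mn] x An.
by apply: IH => //; apply: dA An; exact: (leq_trans m1 mn).
Qed.

Lemma lim_sup_late_miss_null {R : realType} {d} {Y : measurableType d}
    {nu : probability Y R} {mu : probability (seq_space Y) R}
    (A : nat -> set Y) (n : nat -> nat) (C : R) (M : nat) :
  is_product_measure nu mu -> (forall k, (1 <= k)%N -> measurable (A k)) ->
  (0 < M)%N -> 1 < C * M%:R / M.+1%:R -> (4 <= n 0)%N ->
  (forall k, (n k < n k.+1)%N) -> (forall k, (n k.+1 * M <= n k * M.+1)%N) ->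
  (forall k, (n k * (2 * M).+1 <= n k.+1 * (2 * M))%N) ->
  (forall k, C * ln (ln (n k)%:R) / (n k)%:R <= fine (nu (A (n k)))) ->
  mu (lim_sup_set (fun k => miss (A (n k.+1)) 0 (n k))) = 0%E.
Proof.
move=> muP mA M0 s1 n4 nS ratio growth nuA.
have n4k k : (4 <= n k)%N.
  by elim: k => // k IH; rewrite (leq_trans IH)// ltnW.
have mAn k : measurable (A (n k)) by apply: mA; rewrite (leq_trans _ (n4k k)).
apply: lim_sup_set_cvg0 => [k|]; first exact: measurable_miss.
set s := C * M%:R / M.+1%:R in s1.
have C0 : 0 < C.
  rewrite -(@pmulr_lgt0 _ M%:R) ?ltr0n// -(@pmulr_lgt0 _ M.+1%:R^-1)//.
  exact: lt_trans s1.
pose c : R := ln (ln ((2 * M).+1%:R / (2 * M)%:R)).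
(* The first factor comes from the shift [c] in the lower bound for ln ln, the second from
   telescoping with exponent [s - 1]. *)
pose K := expR (- (s * c)) * (s - 1)^-1.
have K0 : 0 <= K by rewrite mulr_ge0 ?expR_ge0// invr_ge0; lra.
pose t k : R := K * expR (- ((s - 1) * ln k.+1%:R)).
apply: (@nneseries_telescope_lty _ _ t) => k.
- exact: measure_ge0.
- rewrite [X in (X <= _)%E](mu_miss _ _ _ muP)// subn0 lee_fin.
  set p := fine _.
  have p1 : p <= 1 by rewrite -lee_fin fineK ?fin_num_measure// probability_le1.
  have := miss_late_prob_le C p M _ _ C0 p1 (n4k k.+1) M0 (ratio k) (nuA k.+1).
  move=> /le_trans; apply.
  have lnln := geometric_lnln_ge M n M0 n4 growth k.
  rewrite -/s.
  rewrite (@le_trans _ _ (expR (- (s * c)) * expR (- (s * ln (k.+1%:R + 1)))))//.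
    rewrite -expRD ler_expR -opprD -mulrDr lerN2 ler_wpM2l//.
      exact: ltW (lt_trans ltr01 s1).
    rewrite addrC; exact: lnln.
  rewrite /t -mulrBr /K -(mulrA (expR _)) ler_wpM2l ?expR_ge0//.
  have s0 : 0 < s - 1 by lra.
  have := expR_ln_telescope (s - 1) k.+1%:R s0 (ltr0Sn _ _).
  by rewrite subrKC natr1.
- by rewrite mulr_ge0// expR_ge0.
Qed.

Theorem corollary1p3 (R : realType) (d : measure_display) (Y : measurableType d)
    (nu : probability Y R) (A : nat -> set Y)
    (mA : forall n, (1 <= n)%N -> measurable (A n))
    (decA : forall n, (1 <= n)%N -> A n.+1 `<=` A n)
    (nuA : nu (A n) @[n --> \oo] --> 0%E)
    (mu : probability (seq_space Y) R) (mu_prod : is_product_measure nu mu) :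
  let B := fun n : nat => [set x : seq_space Y | A n (x 0%N)] in
  let H := eventually_always_hitting (@left_shift d Y) B in
  ((exists C : R, 1 < C /\
      \forall m \near \oo, ((C * ln (ln m%:R) / m%:R)%:E <= mu (B m))%E) ->
    mu H = 1%E) /\
  ((\forall m \near \oo, (mu (B m) <= (ln (ln m%:R) / m%:R)%:E)%E) ->
    mu H = 0%E).
Proof.
move=> B H.
have mH : measurable H by exact: measurable_eventually_always_hitting.
have muB m : (1 <= m)%N -> mu (B m) = nu (A m).
  move=> m1; have -> : B m = box (fun=> A m) 1.
    apply/seteqP; split=> x /= xA; last exact: xA.
    by case.
  by rewrite mu_prod ?big_ord1// => _; exact: mA.
have muBE m : (1 <= m)%N -> mu (B m) = (fine (nu (A m)))%:E.
  by move=> m1; rewrite muB// fineK// fin_num_measure//; exact: mA.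
split=> [[C [C1 [N _ HN]]]|[N _ HN]].
  (* M > 1 / (C - 1) is equivalent to C M > M + 1. *)
  pose M := (Num.truncn (C - 1)^-1).+1.
  have M0 : (0 < M)%N by [].
  have s1 : 1 < C * M%:R / M.+1%:R.
    rewrite ltr_pdivlMr// mul1r -natr1.
    have : (C - 1)^-1 < M%:R by exact: truncnS_gt.
    rewrite -div1r ltr_pdivrMr ?subr_gt0//; lra.
  have [n [nN nS ratio growth]] := bounded_ratio_sequence M (maxn 4 N) M0.
  move: nN; rewrite geq_max => /andP[n4 nN].
  have nk k : (4 <= n k)%N && (N <= n k)%N.
    by elim: k => [|k /andP[IH4 IHN]]; rewrite ?n4// !(leq_trans _ (ltnW (nS k))).
  have lim0 : mu (lim_sup_set (fun k => miss (A (n k.+1)) 0 (n k))) = 0%E.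
    apply: (lim_sup_late_miss_null A n C M mu_prod) => // k.
    have /andP[k4 kN] := nk k; rewrite -lee_fin -muBE; last exact: leq_trans k4.
    exact: HN.
  have : mu (~` H) = 0%E.
    apply: subset_measure0 lim0; first exact: measurableC.
      apply: bigcap_measurableType => K _; apply: bigcup_measurable => k _.
      apply: measurable_miss; apply: mA.
      by have /andP[k4 _] := nk k.+1; exact: leq_trans k4.
    rewrite /H eventually_always_hittingE => x xH K _ /=.
    have [m nKm xm] : exists2 m, (n K <= m)%N & miss (A m) 0 m x.
      apply: contrapT => h; apply: xH; exists (n K) => // m /= nKm xm.
      by apply: h; exists m.
    (* For n_j <= m < n_(j+1), missing [A m] up to [m] implies missing the smaller set A (n_(j+1))
       up to n_j. *)
    have [j Kj /andP[njm mnj]] := increasing_bracket n K m nS nKm.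
    exists j => // i /andP[i0 inj] Ai.
    apply: (xm i); first by rewrite i0 (leq_trans inj).
    apply: (decreasing_sets_le A decA m _ _ _ Ai).
    rewrite (ltnW mnj) andbT (leq_trans _ njm)//.
    by have /andP[j4 _] := nk j; exact: leq_trans j4.
  rewrite probability_setC// -[mu H]fineK ?fin_num_measure// -EFinB => -[h].
  by congr EFin; lra.
pose V K := \bigcap_(j in [set j | (K <= j)%N]) ~` @miss _ Y (A j`!) 0 j`!.
have V0 K : mu (V K) = 0%E.
  apply: (miss_factorials_null A (maxn 1 N) K mu_prod mA) => m.
  rewrite geq_max => /andP[m1 mN]; rewrite -lee_fin -muBE//; exact: HN.
have mV K : measurable (V K).
  apply: bigcap_measurableType => j _; apply: measurableC.
  by apply: measurable_miss; apply: mA; exact: fact_gt0.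
(* From m >= K on, hitting at every [m] includes hitting at j! for all j >= K, as j! >= j. *)
apply: subset_measure0 (_ : mu (\bigcup_K V K) = 0%E) => //.
- exact: bigcup_measurable.
- rewrite /H eventually_always_hittingE => x [K _ xK]; exists K => // j Kj.
  by apply: xK; rewrite /= (leq_trans Kj)// fact_geq.
- apply/eqP; rewrite eq_le measure_ge0 andbT.
  rewrite (le_trans (measure_sigma_subadditive mu mV _ (subset_refl _)))//.
    exact: bigcup_measurable.
  by rewrite eseries0 => [|i _ _]; [exact: lexx|exact: V0].
Qed.
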